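(* Let $X$ and $Y$ be locally compact Hausdorff spaces and let $T\colon S(C_0(X,\mathbb{R}))\to S(C_0(Y,\mathbb{R}))$ be a surjective phase-isometry. Then there exist a function $\varepsilon\colon S(C_0(X,\mathbb{R}))\to\{-1,1\}$, a continuous function $\alpha\colon Y\to\{-1,1\}$ and a homeomorphism $\sigma\colon Y\to X$ such that $$T(f)(q)=\varepsilon(f)\,\alpha(q)\,f(\sigma(q))$$ for all $f\in S(C_0(X,\mathbb{R}))$ and $q\in Y$.
   Context: For a locally compact Hausdorff space $L$, $C_0(L,\mathbb{R})$ is the real Banach space of all continuous real-valued functions on $L$ vanishing at infinity, with the supremum norm $\|h\|=\sup_{x\in L}|h(x)|$. For a real Banach space $E$, $S(E)=\{f\in E:\|f\|=1\}$ denotes its unit sphere. A map $T\colon S(E_1)\to S(E_2)$ (not assumed continuous) between unit spheres of real Banach spaces is a phase-isometry if $\{\|T(f)+T(g)\|,\|T(f)-T(g)\|\}=\{\|f+g\|,\|f-g\|\}$ (equality of sets) for all $f,g\in S(E_1)$. *)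

(* Defs.v *)
From HB Require Import structures.
From mathcomp Require Import all_boot all_order all_algebra.
From mathcomp Require Import all_classical all_reals all_analysis.

Set Implicit Arguments.
Unset Strict Implicit.
Unset Printing Implicit Defensive.

Import Order.TTheory GRing.Theory Num.Theory.
Import numFieldNormedType.Exports.

Local Open Scope classical_set_scope.
Local Open Scope ring_scope.

Definition homeomorphism (X Y : topologicalType) (f : X -> Y) : Prop :=
  continuous f /\ exists g : Y -> X, [/\ cancel f g, cancel g f & continuous g].

Definition vanishes_at_infinity (R : realType) (X : topologicalType)
    (f : X -> R) : Prop :=
  forall e : R, 0 < e ->
    exists2 K : set X, compact K & forall x, ~ K x -> `|f x| < e.

Section C0.
Context (X : topologicalType) (R : realType).

Definition C0_pred : {pred X -> R} :=
  mem [set f : X -> R | continuous f /\ vanishes_at_infinity f].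

Lemma C0_submod_closed : submod_closed C0_pred.
Proof.
split.
  apply: mem_set; split; first by move=> x; exact: cvg_cst.
  by move=> e e0; exists set0; [exact: compact0|move=> x _; rewrite normr0].
move=> a f g /set_mem[cf vf] /set_mem[cg vg]; apply: mem_set; split.
  move=> x; apply: (@continuousD _ R^o _ (a *: f) g); last exact: cg.
  by apply: (@continuousM _ _ (cst a) f); [exact: cvg_cst|exact: cf].
move=> e e0.
have e20 : 0 < e / 2 by rewrite divr_gt0.
have a10 : 0 < `|a| + 1 by rewrite ltr_wpDl.
have [K cK fK] := vf (e / 2 / (`|a| + 1)) (divr_gt0 e20 a10).
have [L cL gL] := vg _ e20.
exists (K `|` L); first exact: compactU.
move=> x /not_orP[/fK fx /gL gx].
apply: (le_lt_trans (ler_normD _ _)).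
rewrite [ltRHS]splitr ler_ltD//.
rewrite -[_ x]/(a * f x) normrM.
rewrite (le_trans (ler_wpM2l (normr_ge0 a) (ltW fx)))//.
rewrite mulrCA -[leRHS]mulr1 ler_wpM2l ?(ltW e20)//.
by rewrite ler_pdivrMr// mul1r lerDl.
Qed.

HB.instance Definition _ := GRing.isSubmodClosed.Build _ _ C0_pred
  C0_submod_closed.

Record C0 := MkC0 { C0_fun :> X -> R; C0_funP : C0_fun \in C0_pred }.

HB.instance Definition _ := [isSub for C0_fun].
HB.instance Definition _ := [Choice of C0 by <:].
HB.instance Definition _ := [SubChoice_isSubLmodule of C0 by <:].

(* On an empty X the set below is empty and its sup is 0 by convention, which
   is the norm of the only element of C0. *)
Definition C0_norm (f : C0) : R := sup (range (fun x => `|f x|)).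

Lemma C0_bounded (f : C0) : has_ubound (range (fun x => `|f x|)).
Proof.
have [cf vf] := set_mem (C0_funP f).
have [K cK fK] := vf 1 ltr01.
have /compact_bounded[M [_ Mf]] : compact ((f : X -> R^o) @` K).
  by apply: continuous_compact => //; exact: continuous_subspaceT.
exists (Num.max 1 (M + 1)) => _ [x _ <-]; rewrite le_max.
have [Kx|/fK/ltW -> //] := pselect (K x).
by apply/orP; right; apply: (Mf (M + 1)); [rewrite ltrDl|exists x].
Qed.

Lemma C0_norm_ub (f : C0) x : `|f x| <= C0_norm f.
Proof. by apply: ub_le_sup; [exact: C0_bounded|exists x]. Qed.

Lemma C0_norm_ge0 (f : C0) : 0 <= C0_norm f.
Proof.
have [[_ [x _ _]]|] := pselect (range (fun x => `|f x|) !=set0).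
  exact: le_trans (normr_ge0 _) (C0_norm_ub f x).
by move=> /nonemptyPn fE; rewrite /C0_norm fE sup0.
Qed.

Lemma C0_norm_le (f : C0) (M : R) :
  0 <= M -> (forall x, `|f x| <= M) -> C0_norm f <= M.
Proof.
move=> M0 fM; have [ne|] := pselect (range (fun x => `|f x|) !=set0).
  by apply: ge_sup => // _ [x _ <-].
by move=> /nonemptyPn fE; rewrite /C0_norm fE sup0.
Qed.

Lemma C0_ler_normD (f g : C0) : C0_norm (f + g) <= C0_norm f + C0_norm g.
Proof.
apply: C0_norm_le => [|x]; first by rewrite addr_ge0 ?C0_norm_ge0.
by rewrite (le_trans (ler_normD _ _))// lerD ?C0_norm_ub.
Qed.

Lemma C0_normrZ (a : R) (f : C0) : C0_norm (a *: f) = `|a| * C0_norm f.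
Proof.
have Zle (b : R) (g : C0) : C0_norm (b *: g) <= `|b| * C0_norm g.
  apply: C0_norm_le => [|x]; first by rewrite mulr_ge0 ?C0_norm_ge0.
  by rewrite -[_ x]/(b * g x) normrM ler_wpM2l ?C0_norm_ub.
apply/eqP; rewrite eq_le Zle/=; have [->|a0] := eqVneq a 0.
  by rewrite normr0 mul0r C0_norm_ge0.
rewrite -ler_pdivlMl ?normr_gt0// -normfV.
by rewrite -{1}[f](scalerK a0) Zle.
Qed.

Lemma C0_normr0_eq0 (f : C0) : C0_norm f = 0 -> f = 0.
Proof.
move=> f0; apply/val_inj/funext => x; apply/eqP.
by rewrite -normr_eq0 eq_le normr_ge0 -f0 C0_norm_ub.
Qed.

HB.instance Definition _ := Lmodule_isNormed.Build R C0
  C0_ler_normD C0_normrZ C0_normr0_eq0.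

Lemma C0_normE (f : C0) : `|f| = sup (range (fun x => `|f x|)).
Proof. by []. Qed.

End C0.

Definition unit_sphere (R : realType) (E : normedModType R) : set E :=
  [set f | `|f| = 1].
Arguments unit_sphere {R} E _.

Definition phase_isometry (R : realType) (E1 E2 : normedModType R)
    (T : unit_sphere E1 -> unit_sphere E2) : Prop :=
  forall f g : unit_sphere E1,
    [set `|\val (T f) + \val (T g)|; `|\val (T f) - \val (T g)|] =
    [set `|\val f + \val g|; `|\val f - \val g|].

(* Main.v *)
Require Import Defs.
From mathcomp Require Import all_boot all_order all_algebra.
From mathcomp Require Import all_classical all_reals all_analysis.
From mathcomp Require Import ring lra.
Import Order.TTheory GRing.Theory Num.Theory.
Import numFieldNormedType.Exports.
Local Open Scope classical_set_scope.
Local Open Scope ring_scope.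

(** Only two numbers are extracted from a pair [f, g] of unit vectors: the
    larger and the smaller of [`|f + g|] and [`|f - g|]. A phase-isometry
    preserves both, and each carries one half of the theorem.

    The larger one is the supremum of [`|f x| + `|g x|], so it only sees the
    moduli. It equals 2 exactly when the peak sets [{`|f| = 1}] and
    [{`|g| = 1}] meet, so [T] preserves the relation of meeting peak sets, and
    with it, by Urysohn's lemma, inclusion of peak sets. For a point [x], the
    peak sets of the images [T f] with [`|f x| = 1] then form a base of a
    filter of nonempty compact sets, and a cluster point [q] of it satisfies
    [`|T f q| = 1] as soon as [`|f x| = 1] (peak_point). Testing an arbitrary
    [f] against functions peaking at [x] with small support improves this to
    [`|T f q| <= `|f x|] for all [f] (norm_le_point). A right inverse of [T] is
    again a phase-isometry, and playing both against each other yields a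
    homeomorphism [s : Y -> X] with [`|T f q| = `|f (s q)|]
    (modulus_homeomorphism).

    The smaller one sees relative signs. Fix two points [p], [q] of [Y] with
    images [x], [y], and let [g] be of modulus 1 at [x] and [y], of constant
    sign near each of them, and supported so close to these points that [f]
    keeps its sign there. If [f * g] has the same sign at [x] and [y], then the
    smaller number is at most 1; if the signs differ, it exceeds 1
    (minnorm_le1, minnorm_gt1). Hence, among the
    functions whose values at [x] and [y] have a product of a given sign, [T]
    either always keeps that sign or always reverses it (sign_locked). It
    cannot keep one sign and reverse the other, since then all images would
    have the same relative sign at [p] and [q], against surjectivity
    (relative_sign). So the product of the ratios [T f / (f \o s)] at [p] and
    at [q] is a sign independent of [f], for [f] nonzero at [x] and [y].
    Freezing one of the two points at a base point defines [alpha] up to the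
    harmless choice of a global sign, and [eps f] is the remaining sign. *)

(** * Functions vanishing at infinity and their unit sphere *)

Section C0_functions.
Context {R : realType} {X : topologicalType}.
Implicit Types f g h : C0 X R.

Lemma C0_continuous f : continuous (f : X -> R).
Proof. by have [] := set_mem (C0_funP f). Qed.

Lemma C0_vanishes f : vanishes_at_infinity (f : X -> R).
Proof. by have [] := set_mem (C0_funP f). Qed.

Lemma C0_le_norm f x : `|f x| <= `|f|.
Proof. exact: C0_norm_ub. Qed.

Lemma C0_norm_leP f (M : R) : 0 <= M -> (forall x, `|f x| <= M) -> `|f| <= M.
Proof. exact: C0_norm_le. Qed.

(** Outside a compact set [`|f|] stays below half of its supremum, so the
    supremum is a maximum over that compact set. *)
Lemma C0_norm_attained f : f != 0 -> exists x, `|f x| = `|f|.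
Proof.
rewrite -normr_gt0 => f0.
have f20 : 0 < `|f| / 2 by rewrite divr_gt0.
have [K cK Kf] := C0_vanishes f _ f20.
have K0 : K !=set0.
  apply/set0P/negP => /eqP K0.
  have : `|f| <= `|f| / 2.
    apply: C0_norm_leP; first exact: ltW.
    by move=> x; apply/ltW/Kf; rewrite K0.
  lra.
have [|c _ cmax] := @compact_EVT_max X R (fun x => `|f x|) K K0 cK.
  apply: continuous_subspaceT => x.
  by apply: cvg_norm; exact: C0_continuous.
exists c; apply/eqP; rewrite eq_le C0_le_norm/=.
have : `|f| <= Num.max `|f c| (`|f| / 2).
  apply: C0_norm_leP => [|x]; first by rewrite le_max normr_ge0.
  rewrite le_max; have [Kx|/Kf/ltW ->] := pselect (K x); last exact: orbT.
  by rewrite cmax// mem_set.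
by rewrite le_max => /orP[//|]; lra.
Qed.

End C0_functions.

Local Notation sphere X R := (unit_sphere (C0 X R)).

Section Sphere.
Context {R : realType} {X : topologicalType}.
Implicit Types f g : sphere X R.

Lemma sphere_norm f : `|\val f| = 1.
Proof. by have /set_mem := valP f. Qed.

Lemma sphere_le1 f x : `|\val f x| <= 1.
Proof. by rewrite -(sphere_norm f) C0_le_norm. Qed.

Lemma sphere_attained f : exists x, `|\val f x| = 1.
Proof.
rewrite -(sphere_norm f); apply: C0_norm_attained.
by rewrite -normr_gt0 sphere_norm.
Qed.

Lemma sphere_continuous f : continuous (\val f : X -> R).
Proof. exact: C0_continuous. Qed.

(** Membership in the sphere for functions built pointwise (products, maxima,
    signed sums): vanishing at infinity is inherited from a dominating [f],
    which itself may have norm larger than 1. *)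
Lemma sphere_dominated (f : C0 X R) (h : X -> R) x : continuous h ->
  (forall y, `|h y| <= `|f y|) -> (forall y, `|h y| <= 1) -> `|h x| = 1 ->
  exists g, \val g =1 h.
Proof.
move=> ch hf h1 hx.
have hC : h \in @C0_pred X R.
  apply: mem_set; split=> // e e0; have [K cK Kf] := C0_vanishes f _ e0.
  by exists K => // y /Kf; exact: le_lt_trans.
have hS : MkC0 hC \in unit_sphere (C0 X R).
  apply: mem_set; apply/eqP; rewrite eq_le C0_norm_leP//=.
  by rewrite -hx (C0_le_norm (MkC0 hC)).
by exists (SigSub hS).
Qed.

Lemma open_sphere_pos f (c : R) : open [set x | 0 < c * \val f x].
Proof.
have -> : [set x | 0 < c * \val f x] =
    (fun x => c * \val f x) @^-1` [set r | 0 < r] by [].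
apply: open_comp; last exact: open_gt.
by move=> x _; apply: cvgM; [exact: cvg_cst|exact: sphere_continuous].
Qed.

Definition peak f : set X := [set x | `|\val f x| = 1].

Lemma closed_peak f : closed (peak f).
Proof.
have -> : peak f = (fun x => `|\val f x|) @^-1` [set 1] by [].
apply: closed_comp; last exact: closed_eq.
by move=> x _; apply: cvg_norm; exact: sphere_continuous.
Qed.

Lemma compact_peak f : compact (peak f).
Proof.
have [K cK Kf] := C0_vanishes (\val f) _ (@ltr01 R).
apply: subclosed_compact cK _; first exact: closed_peak.
by move=> x fx; apply: contrapT => /Kf; rewrite fx ltxx.
Qed.

End Sphere.

(** * Bump functions *)

Section Bumps.
Context {R : realType} {X : topologicalType}.
Hypotheses (lcX : locally_compact [set: X]) (hX : hausdorff_space X).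

(** Urysohn's lemma, applied to the complement of [U] intersected with the
    interior of a compact neighbourhood of [x], so that the function obtained
    has compact support. *)
Lemma exists_bump (U : set X) x : open U -> U x ->
  exists g : sphere X R, [/\ \val g x = 1, forall y, 0 <= \val g y &
    forall y, ~ U y -> \val g y = 0].
Proof.
move=> oU Ux.
have [K] := lcX x I; rewrite withinET => Kx [cK clK].
pose B := ~` (U `&` K^°).
have clB : closed B by rewrite closedC; apply: openI => //; exact: open_interior.
have /(@uniform_separatorP _ R)[f [cf f01 f0 f1]] :
    uniform_separator [set x] B.
  by apply: (@locally_compact_completely_regular X R lcX hX) => //; apply; split.
have fx : f x = 0 by apply: f0; exists x.
have fB y : B y -> f y = 1 by move=> By; apply: f1; exists y.
have f01' y : 0 <= f y <= 1.
  by have := f01 (f y) (ex_intro2 _ _ y I erefl); rewrite /= in_itv.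
pose h y := 1 - f y.
have ch : continuous h.
  by move=> y; apply: cvgB; [exact: cvg_cst|exact: cf].
have hC : h \in @C0_pred X R.
  apply: mem_set; split => // e e0; exists K => // y nKy.
  by rewrite /h fB ?subrr ?normr0// => -[_ /interior_subset].
have hx : h x = 1 by rewrite /h fx subr0.
have [||||g gh] := @sphere_dominated R X (MkC0 hC : C0 X R) h x => //.
- by move=> y; rewrite /h ger0_norm; have := f01' y; lra.
- by rewrite hx normr1.
exists g; split=> [|y|y nUy]; rewrite gh //.
  by rewrite /h; have := f01' y; lra.
by rewrite /h fB ?subrr// => -[].
Qed.

Lemma exists_bump_seq x s : exists g : sphere X R,
  {in x :: s, forall y, \val g y = 1} /\ forall y, 0 <= \val g y.
Proof.
elim: s => [|y s [u [us u0]]].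
  have [g [gx g0 _]] := exists_bump setT x openT I.
  by exists g; split=> // y; rewrite inE => /eqP ->.
have [v [vy v0 _]] := exists_bump setT y openT I.
pose h z := Num.max (\val u z) (\val v z).
have u1 z : \val u z <= 1 by rewrite (le_trans (ler_norm _)) ?sphere_le1.
have v1 z : \val v z <= 1 by rewrite (le_trans (ler_norm _)) ?sphere_le1.
have h1 z : z \in [:: x, y & s] -> h z = 1.
  rewrite 2!inE orbCA => /orP[/eqP->|zs]; apply/eqP.
    by rewrite eq_le ge_max u1 v1 /= le_max vy lexx orbT.
  by rewrite eq_le ge_max u1 v1 /= le_max us ?lexx// inE.
have h0 z : 0 <= h z by rewrite le_max u0.
have [||||g gh] := @sphere_dominated R X (\val u + \val v) h x.
- by move=> z; apply: (@continuous_max _ _ (\val u) (\val v));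
    exact: sphere_continuous.
- move=> z; rewrite ger0_norm//.
  have -> : (\val u + \val v : C0 X R) z = \val u z + \val v z by [].
  by rewrite ger0_norm ?addr_ge0// ge_max lerDl lerDr u0 v0.
- by move=> z; rewrite ger0_norm// ge_max u1 v1.
- by rewrite h1 ?mem_head// normr1.
by exists g; split=> z; rewrite gh; [exact: h1|exact: h0].
Qed.

(** The function is [u + r * v] for bumps [u] at [x] and [v] at [y] with
    disjoint supports. The last clause records the sign of [g] wherever it is
    nonzero, which is what the sign argument needs. *)
Lemma exists_bump_signed (U V : set X) x y (r : R) : x <> y -> `|r| = 1 ->
  open U -> open V -> U x -> V y ->
  exists g : sphere X R, [/\ \val g x = 1, \val g y = r &
    forall z, [\/ \val g z = 0, U z /\ 0 <= \val g z |
                  V z /\ 0 <= r * \val g z]].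
Proof.
move=> xy r1 oU oV Ux Vy.
have := hX; rewrite open_hausdorff => /(_ x y)[|[A B]/=]; first exact/eqP.
move=> [/set_mem Ax /set_mem By] [oA oB /eqP AB].
have [|u [ux u0 uU]] := exists_bump (U `&` A) x (openI oU oA); first by split.
have [|v [vy v0 vV]] := exists_bump (V `&` B) y (openI oV oB); first by split.
have uv z : \val u z = 0 \/ \val v z = 0.
  have [Az|nAz] := pselect (A z); last by left; apply: uU => -[].
  right; apply: vV => -[_ Bz].
  by have : (A `&` B) z by []; rewrite AB.
pose h z := \val u z + r * \val v z.
have hu z : \val v z = 0 -> h z = \val u z.
  by rewrite /h => ->; rewrite mulr0 addr0.
have hv z : \val u z = 0 -> h z = r * \val v z.
  by rewrite /h => ->; rewrite add0r.
have vx : \val v x = 0.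
  by have [|//] := uv x; rewrite ux => /eqP; rewrite oner_eq0.
have uy : \val u y = 0.
  by have [//|] := uv y; rewrite vy => /eqP; rewrite oner_eq0.
have [||||g gh] := @sphere_dominated R X (\val u + r *: \val v) h x => //.
- move=> z; apply: cvgD; first exact: sphere_continuous.
  by apply: cvgM; [exact: cvg_cst|exact: sphere_continuous].
- by move=> z; have [/hv ->|/hu ->] := uv z;
    rewrite ?normrM ?r1 ?mul1r sphere_le1.
- by rewrite hu// ux normr1.
exists g; split; rewrite ?gh; first by rewrite hu.
  by rewrite hv// vy mulr1.
move=> z; rewrite gh.
have [uz|uz] := eqVneq (\val u z) 0; last first.
  have vz : \val v z = 0 by case: (uv z) => // /eqP; rewrite (negbTE uz).
  constructor 2; rewrite hu//; split => //.
  by apply: contrapT => nUz; move/eqP: uz; apply; apply: uU => -[].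
have [vz|vz] := eqVneq (\val v z) 0; first by constructor 1; rewrite hu.
constructor 3; rewrite hv//; split.
  by apply: contrapT => nVz; move/eqP: vz; apply; apply: vV => -[].
by rewrite mulrA -expr2 -real_normK ?num_real// r1 expr1n mul1r.
Qed.

End Bumps.

(** * The larger and the smaller of the norms of the sum and the difference *)

Lemma norm_eq1 {R : realDomainType} (a : R) : `|a| = 1 -> a = 1 \/ a = -1.
Proof.
by move/eqP; rewrite eqr_norml ler01 andbT => /orP[]/eqP ->; [left|right].
Qed.

Section Norms.
Context {R : realType} {X : topologicalType}.
Implicit Types f g : sphere X R.

Definition maxnorm f g : R :=
  Num.max `|\val f + \val g| `|\val f - \val g|.

Definition minnorm f g : R :=
  Num.min `|\val f + \val g| `|\val f - \val g|.

Lemma normr_add_max (a b : R) : `|a| + `|b| = Num.max `|a + b| `|a - b|.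
Proof.
apply/eqP; rewrite eq_le ge_max ler_normD ler_normB !andbT le_max.
by case: (ger0P a); case: (ger0P b); case: (ger0P (a + b));
  case: (ger0P (a - b)) => *; apply/orP; (left; lra) || (right; lra).
Qed.

(** With [maxnorm_le], this identifies [maxnorm f g] as the supremum of
    [`|f x| + `|g x|]. *)
Lemma maxnorm_ge f g x : `|\val f x| + `|\val g x| <= maxnorm f g.
Proof.
rewrite normr_add_max ge_max !le_max.
by rewrite (C0_le_norm (\val f + \val g)) (C0_le_norm (\val f - \val g)) orbT.
Qed.

Lemma maxnorm_le f g (M : R) : (forall x, `|\val f x| + `|\val g x| <= M) ->
  maxnorm f g <= M.
Proof.
move=> fgM; have [x _] := sphere_attained f.
have M0 : 0 <= M by rewrite (le_trans _ (fgM x))// addr_ge0.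
rewrite ge_max !C0_norm_leP//= => y.
  exact: le_trans (ler_normB (\val f y) (\val g y)) (fgM y).
exact: le_trans (ler_normD (\val f y) (\val g y)) (fgM y).
Qed.

(** The value 2 is the largest possible one, and since norms are attained it
    forces both moduli to be 1 at a common point. *)
Lemma maxnorm_eq2P f g : maxnorm f g = 2 <-> peak f `&` peak g !=set0.
Proof.
split=> [fg2|[x [/= fx gx]]]; last first.
  apply/eqP; rewrite eq_le maxnorm_le => [|y].
    by have := maxnorm_ge f g x; rewrite fx gx.
  by rewrite (_ : 2 = 1 + 1)// lerD// sphere_le1.
have [h h2 hfg] : exists2 h : C0 X R, `|h| = 2 &
    forall x, `|h x| <= `|\val f x| + `|\val g x|.
  move: fg2; rewrite /maxnorm; case: leP => _ h2.
    by exists (\val f - \val g) => // x; exact: (ler_normB (\val f x)).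
  by exists (\val f + \val g) => // x; exact: (ler_normD (\val f x)).
have [|x] := C0_norm_attained h; first by rewrite -normr_gt0 h2.
rewrite h2 => hx; exists x.
have := hfg x; rewrite hx /peak/=.
by have := sphere_le1 f x; have := sphere_le1 g x; split; lra.
Qed.

(** Two reals of the same sign and of modulus at most 1 have a difference of
    modulus at most 1. *)
Lemma minnorm_le1 f g : (forall z, 0 <= \val f z * \val g z) \/
    (forall z, \val f z * \val g z <= 0) -> minnorm f g <= 1.
Proof.
move=> fg; rewrite ge_min; apply/orP.
case: fg => fg; [right|left]; apply: C0_norm_leP => // z;
  have := fg z; have := sphere_le1 f z; have := sphere_le1 g z;
  rewrite !ler_norml => /andP[? ?] /andP[? ?] ?.
  change ((\val f - \val g) z) with (\val f z - \val g z).
  by apply/andP; split; nra.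
change ((\val f + \val g) z) with (\val f z + \val g z).
by apply/andP; split; nra.
Qed.

(** One of [x], [y] makes the norm of the sum exceed 1, the other one the norm
    of the difference. *)
Lemma minnorm_gt1 f g x y : `|\val g x| = 1 -> `|\val g y| = 1 ->
  (\val f x * \val g x) * (\val f y * \val g y) < 0 -> 1 < minnorm f g.
Proof.
move=> gx gy.
wlog fgx : x y gx gy / 0 < \val f x * \val g x => [hw|] fgxy.
  have [fx0|fx0|fx0] := ltgtP (\val f x * \val g x) 0.
  - apply: (hw y x) => //; last by rewrite mulrC.
    by move: fgxy; rewrite nmulr_rlt0.
  - exact: hw gx gy fx0 fgxy.
  - by move: fgxy; rewrite fx0 mul0r ltxx.
have fgy : \val f y * \val g y < 0 by move: fgxy; rewrite pmulr_rlt0.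
rewrite lt_min; apply/andP; split.
  apply: lt_le_trans (C0_le_norm (\val f + \val g) x).
  change ((\val f + \val g) x) with (\val f x + \val g x).
  by rewrite ltr_normr; move: fgx; have [->|->] := norm_eq1 _ gx => fgx;
    apply/orP; [left|right]; lra.
apply: lt_le_trans (C0_le_norm (\val f - \val g) y).
change ((\val f - \val g) y) with (\val f y - \val g y).
by rewrite ltr_normr; move: fgy; have [->|->] := norm_eq1 _ gy => fgy;
  apply/orP; [right|left]; lra.
Qed.

End Norms.


Lemma set2_min_max {R : realType} (a b c d : R) : [set a; b] = [set c; d] ->
  Num.min a b = Num.min c d /\ Num.max a b = Num.max c d.
Proof.
move=> E.
have h (x : R) : (x = a \/ x = b) <-> (x = c \/ x = d).
  by have := congr1 (fun A : set R => A x) E => /= ->.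
have [ha _] := h a; have [hb _] := h b; have [_ hc] := h c; have [_ hd] := h d.
have [] := ha (or_introl erefl); have [] := hb (or_intror erefl);
have [] := hc (or_introl erefl); have [] := hd (or_intror erefl);
  by move=> *; subst; first [done | split; [rewrite minC|rewrite maxC]].
Qed.

(** * Recovering the points from the moduli *)

Section PeakTransfer.
Context {R : realType} {X Y : topologicalType}.
Hypotheses (lcX : locally_compact [set: X]) (hX : hausdorff_space X).
Hypotheses (lcY : locally_compact [set: Y]) (hY : hausdorff_space Y).
Variable T : sphere X R -> sphere Y R.
Hypothesis maxT : forall f g, maxnorm (T f) (T g) = maxnorm f g.
(* Surjectivity is only asked for up to the modulus: the lemmas are also applied
   to a right inverse [S] of a phase-isometry [T], and [S (T f)] is then known
   to be [f] up to sign. *)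
Hypothesis surjT : forall k : sphere Y R, exists f, forall q,
  `|\val (T f) q| = `|\val k q|.

Lemma peak_meet f g :
  (peak (T f) `&` peak (T g) !=set0) <-> (peak f `&` peak g !=set0).
Proof. by rewrite -!maxnorm_eq2P maxT. Qed.

(** Inclusion of peak sets can be expressed by which peak sets they meet: a
    point of [peak (T g)] outside [peak (T f)] would carry a bump whose peak
    set meets the former and not the latter. *)
Lemma peak_subset f g : peak g `<=` peak f -> peak (T g) `<=` peak (T f).
Proof.
move=> gf p gp; apply: contrapT => nfp.
have oU : open (~` peak (T f)) by rewrite openC; exact: closed_peak.
have [k [kp _ kU]] := exists_bump (R := R) lcY hY _ p oU nfp.
have [h hk] := surjT k.
have [z [hz gz]] : peak h `&` peak g !=set0.
  by apply/peak_meet; exists p; split=> //; rewrite /peak/= hk kp normr1.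
have [w [hw fw]] : peak (T h) `&` peak (T f) !=set0.
  by apply/peak_meet; exists z; split=> //; exact: gf.
move: hw; rewrite /peak/= hk kU; last by move=> /(_ fw).
by rewrite normr0 => /eqP; rewrite eq_sym oner_eq0.
Qed.

(** The sets [peak (T f)] with [x] in [peak f] generate a filter, since the
    product [f * g] has peak set [peak f `&` peak g]; compactness then provides
    a common point. *)
Lemma peak_point x : exists q, forall f, peak f x -> peak (T f) q.
Proof.
have [f0 [f0x _ _]] := exists_bump (R := R) lcX hX setT x openT I.
have pf0 : peak f0 x by rewrite /peak/= f0x normr1.
pose F := filter_from [set f | peak f x] (fun f => peak (T f)).
have FF : ProperFilter F.
  apply: filter_from_proper; last by move=> f _; exact: sphere_attained.
  apply: filter_from_filter; first by exists f0.
  move=> f g fx gx.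
  have [||||h hfg] := @sphere_dominated R X (\val g)
    (fun z => \val f z * \val g z) x.
  - by move=> z; apply: cvgM; exact: sphere_continuous.
  - by move=> z; rewrite normrM ler_piMl// sphere_le1.
  - by move=> z; rewrite normrM mulr_ile1// sphere_le1.
  - by rewrite normrM fx gx mulr1.
  have hM z : peak h z -> `|\val f z| * `|\val g z| = 1.
    by rewrite /peak/= hfg normrM.
  have hf : peak h `<=` peak f.
    move=> z /hM; have := sphere_le1 f z; have := sphere_le1 g z.
    have := normr_ge0 (\val f z); have := normr_ge0 (\val g z).
    by rewrite /peak/=; nra.
  have hg : peak h `<=` peak g.
    move=> z /hM; have := sphere_le1 f z; have := sphere_le1 g z.
    have := normr_ge0 (\val f z); have := normr_ge0 (\val g z).
    by rewrite /peak/=; nra.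
  exists h; first by rewrite /peak/= hfg normrM fx gx mulr1.
  by move=> p hp; split; [exact: peak_subset hf _ hp|exact: peak_subset hg _ hp].
have [q [_ Fq]] : peak (T f0) `&` cluster F !=set0.
  by apply: (compact_peak (T f0)); exists f0.
exists q => f fx; apply: closed_peak => U Uq.
by apply: Fq => //; exists f.
Qed.

(** If [g] peaks at [x] and vanishes where [`|f|] exceeds [`|f x| + e], then
    [maxnorm f g] is at most [`|f x| + e + 1], while [maxnorm (T f) (T g)] is
    at least [`|T f q| + 1]. *)
Lemma norm_le_point x : exists q, forall f, `|\val (T f) q| <= `|\val f x|.
Proof.
have [q xq] := peak_point x; exists q => f.
apply/ler_addgt0Pr => e e0.
pose U := [set z | `|\val f z| < `|\val f x| + e].
have oU : open U.
  have -> : U = (fun z => `|\val f z|) @^-1` [set r | r < `|\val f x| + e] by [].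
  apply: open_comp; last exact: open_lt.
  by move=> z _; apply: cvg_norm; exact: sphere_continuous.
have [|g [gx g0 gU]] := exists_bump (R := R) lcX hX U x oU.
  by rewrite /U/= ltrDl.
have Tgq : `|\val (T g) q| = 1 by apply: xq; rewrite /peak/= gx normr1.
have : maxnorm f g <= `|\val f x| + e + 1.
  apply: maxnorm_le => z; have [Uz|nUz] := pselect (U z).
    by apply: lerD; [exact: ltW|exact: sphere_le1].
  rewrite gU// normr0 addr0 (le_trans (sphere_le1 f z))//.
  by rewrite lerDr addr_ge0// ltW.
by rewrite -maxT => /(le_trans (maxnorm_ge (T f) (T g) q)); rewrite Tgq lerD2r.
Qed.

End PeakTransfer.

Lemma sphere_separates {R : realType} {X : topologicalType}
    (lcX : locally_compact [set: X]) (hX : hausdorff_space X) (x y : X) :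
  (forall f : sphere X R, `|\val f x| <= `|\val f y|) -> x = y.
Proof.
move=> fxy; apply: contrapT => xy.
have oU : open (~` [set y]).
  by rewrite openC; apply: accessible_closed_set1; exact: hausdorff_accessible.
have [f [fx _ fU]] := exists_bump (R := R) lcX hX _ x oU xy.
have := fxy f; rewrite fx fU; last by move=> /(_ erefl).
by rewrite normr0 normr1 ler10.
Qed.

(** The sets where some [`|f|] is nonzero form a base of the topology of [X],
    and [s] pulls them back to sets of the same kind. *)
Lemma modulus_continuous {R : realType} {X Y : topologicalType}
    (lcX : locally_compact [set: X]) (hX : hausdorff_space X) (s : Y -> X) :
  (forall f : sphere X R, exists k : sphere Y R,
    forall q, `|\val k q| = `|\val f (s q)|) -> continuous s.
Proof.
move=> fk q A /nbhs_interior; rewrite /nbhs/= => Asq.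
have [f [fsq _ fA]] := exists_bump (R := R) lcX hX (A^°) (s q)
  (open_interior A) (nbhs_singleton Asq).
have [k kf] := fk f.
have kc : `|\val k p| @[p --> q] --> `|\val k q|.
  by apply: cvg_norm; exact: sphere_continuous.
have k0 : 0 < `|\val k q| by rewrite kf fsq normr1.
near=> p.
have : 0 < `|\val k p| by near: p; exact: (cvgr_gt _ kc).
rewrite kf; apply: contraPP => nAp.
by rewrite fA ?normr0 ?ltxx// => /interior_subset.
Unshelve. all: by end_near. Qed.

Section PhaseIsometry.
Context {R : realType} {X Y : topologicalType}.
Variable T : sphere X R -> sphere Y R.
Hypothesis phaseT : phase_isometry T.

Lemma phase_maxnorm f g : maxnorm (T f) (T g) = maxnorm f g.
Proof. by have [] := set2_min_max _ _ _ _ (phaseT f g). Qed.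

Lemma phase_minnorm f g : minnorm (T f) (T g) = minnorm f g.
Proof. by have [] := set2_min_max _ _ _ _ (phaseT f g). Qed.

(** [T f = T g] forces one of [f + g] and [f - g] to vanish. *)
Lemma phase_inj_norm f g x : T f = T g -> `|\val f x| = `|\val g x|.
Proof.
move=> Tfg; have : minnorm f g = 0.
  rewrite -phase_minnorm Tfg /minnorm subrr normr0.
  by apply/min_idPr; exact: normr_ge0.
rewrite /minnorm; case: leP => _ /eqP; rewrite normr_eq0.
  by rewrite addr_eq0 => /eqP ->; exact: normrN.
by rewrite subr_eq0 => /eqP ->.
Qed.

End PhaseIsometry.

Lemma modulus_homeomorphism {R : realType} {X Y : topologicalType}
    (lcX : locally_compact [set: X]) (hX : hausdorff_space X)
    (lcY : locally_compact [set: Y]) (hY : hausdorff_space Y)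
    (T : sphere X R -> sphere Y R)
    (surjT : set_surj setT setT T) (phaseT : phase_isometry T) :
  exists2 s : Y -> X, homeomorphism s &
    forall f q, `|\val (T f) q| = `|\val f (s q)|.
Proof.
have /choice[S TS] : forall k, exists f, T f = k.
  by move=> k; have [f _ <-] := surjT k I; exists f.
have phaseS : phase_isometry S by move=> k l; rewrite -phaseT !TS.
have absS f x : `|\val (S (T f)) x| = `|\val f x|.
  by apply: phase_inj_norm phaseT _ _ _ _; rewrite TS.
have le_t x : exists q, forall f, `|\val (T f) q| <= `|\val f x|.
  apply: norm_le_point => //; first exact: phase_maxnorm.
  by move=> k; exists (S k) => q; rewrite TS.
have le_s q : exists x, forall f : sphere X R, `|\val f x| <= `|\val (T f) q|.
  have [||x xq] := norm_le_point lcY hY lcX hX S _ _ q.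
  - exact: phase_maxnorm.
  - by move=> f; exists (T f).
  - by exists x => f; rewrite -absS.
(* Composing the two comparisons bounds every [`|k|] at one point by its
   value at another one, which forces these points to coincide. *)
have abs_s q : exists x, forall f, `|\val (T f) q| = `|\val f x|.
  have [x xq] := le_s q; have [p px] := le_t x.
  suff pq : p = q by exists x => f; apply/eqP; rewrite eq_le xq -pq px.
  apply: (sphere_separates (R := R) lcY hY) => k.
  by rewrite -(TS k) (le_trans (px _)).
have abs_t x : exists q, forall f, `|\val (T f) q| = `|\val f x|.
  have [q qx] := le_t x; have [y yq] := le_s q.
  suff yx : y = x by exists q => f; apply/eqP; rewrite eq_le qx -{1}yx yq.
  by apply: (sphere_separates (R := R) lcX hX) => f; rewrite (le_trans (yq _)).
have [s sE] := choice abs_s; have [t tE] := choice abs_t.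
exists s => //; split.
  by apply: (modulus_continuous (R := R)) => // f; exists (T f) => q; exact: sE.
exists t; split=> [q|x|].
- apply: (sphere_separates (R := R) lcY hY) => k.
  by rewrite -(TS k) tE sE.
- by apply: (sphere_separates (R := R) lcX hX) => f; rewrite -sE tE.
- apply: (modulus_continuous (R := R)) => // k; exists (S k) => x.
  by rewrite -{2}(TS k) tE.
Qed.

(** * Relative signs *)

Section RelativeSigns.
Context {R : realType} {X Y : topologicalType}.
Hypotheses (lcX : locally_compact [set: X]) (hX : hausdorff_space X).
Hypotheses (lcY : locally_compact [set: Y]) (hY : hausdorff_space Y).
Variable T : sphere X R -> sphere Y R.
Hypothesis surjT : forall k, exists f, T f = k.
Hypothesis minT : forall f g, minnorm (T f) (T g) = minnorm f g.
Variable s : Y -> X.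
Implicit Types f g : sphere X R.
Hypothesis absT : forall f q, `|\val (T f) q| = `|\val f (s q)|.

Lemma absT_neq0 f q : (\val (T f) q != 0) = (\val f (s q) != 0).
Proof. by rewrite -normr_gt0 absT normr_gt0. Qed.

(** The hypothesis bounds [minnorm f g], hence [minnorm (T f) (T g)], by 1, so
    that [T f * T g] cannot have opposite signs at [p] and [q]. *)
Lemma sign_coherent f g p q :
  \val f (s p) != 0 -> \val f (s q) != 0 ->
  `|\val g (s p)| = 1 -> `|\val g (s q)| = 1 ->
  (forall z, 0 <= \val f z * \val g z) \/
    (forall z, \val f z * \val g z <= 0) ->
  0 < (\val (T f) p * \val (T f) q) * (\val (T g) p * \val (T g) q).
Proof.
move=> fp fq gp gq /minnorm_le1; rewrite -minT => min1.
have g_neq0 z : `|\val g z| = 1 -> \val g z != 0.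
  by move=> gz; rewrite -normr_gt0 gz.
rewrite lt_neqAle eq_sym !mulf_neq0 ?absT_neq0 ?g_neq0//= leNgt mulrACA.
apply/negP => /minnorm_gt1; rewrite !absT => /(_ gp gq).
by rewrite ltNge min1.
Qed.

(** Both [f1] and [f2] are compared with one function [g], concentrated near
    [s p] and [s q] and with the same relative sign at these points as [f1]
    and [f2]. *)
Lemma sign_locked f1 f2 p q : s p <> s q ->
  0 < (\val f1 (s p) * \val f1 (s q)) * (\val f2 (s p) * \val f2 (s q)) ->
  0 < (\val (T f1) p * \val (T f1) q) * (\val (T f2) p * \val (T f2) q).
Proof.
move=> spq; set x := s p in spq *; set y := s q in spq *.
wlog f12 : / (0 < \val f1 x * \val f1 y /\ 0 < \val f2 x * \val f2 y) \/
             (\val f1 x * \val f1 y < 0 /\ \val f2 x * \val f2 y < 0).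
  move=> hw f12; apply: (hw _ f12); move: f12.
  have [h|h|h] := ltgtP (\val f1 x * \val f1 y) 0.
  - by rewrite nmulr_rgt0//; right.
  - by rewrite pmulr_rgt0//; left.
  - by rewrite h mul0r ltxx.
move=> _.
(* [r] is the common sign of the two products. *)
have [r r1 [rf1 rf2]] : exists2 r : R, `|r| = 1 &
    0 < r * (\val f1 x * \val f1 y) /\ 0 < r * (\val f2 x * \val f2 y).
  case: f12 => -[h1 h2]; [exists 1|exists (-1)]; rewrite ?normrN ?normr1//.
    by rewrite !mul1r.
  by rewrite !mulN1r !oppr_gt0.
have neq0 f : 0 < r * (\val f x * \val f y) -> \val f x != 0 /\ \val f y != 0.
  by move=> /lt0r_neq0; rewrite !mulf_eq0 !negb_or => /and3P[].
have sq_gt0 (a : R) : a != 0 -> 0 < a * a by rewrite -expr2 exprn_even_gt0.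
pose U c d := [set z | 0 < c * \val f1 z] `&` [set z | 0 < d * \val f2 z].
have oU c d : open (U c d) by apply: openI; exact: open_sphere_pos.
have Ux : U (\val f1 x) (\val f2 x) x.
  by split; apply: sq_gt0; have [] := neq0 _ rf1; have [] := neq0 _ rf2.
have Uy : U (\val f1 y) (\val f2 y) y.
  by split; apply: sq_gt0; have [] := neq0 _ rf1; have [] := neq0 _ rf2.
have [g [gx gy gz]] :=
  exists_bump_signed lcX hX _ _ x y r spq r1 (oU _ _) (oU _ _) Ux Uy.
have coherent f : 0 < r * (\val f x * \val f y) ->
    (forall z, [\/ \val g z = 0, 0 < \val f x * \val f z /\ 0 <= \val g z |
                   0 < \val f y * \val f z /\ 0 <= r * \val g z]) ->
    0 < (\val (T f) p * \val (T f) q) * (\val (T g) p * \val (T g) q).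
  move=> rf fg; have [fx fy] := neq0 _ rf.
  (* Off the support of [g] there is nothing to show; near [x], [f] has the sign
     of [f x] and [g] is nonnegative; near [y], [f] has the sign of [r * f x]
     and [g] has the sign of [r]. *)
  have fxg z : 0 <= \val f x * (\val f z * \val g z).
    case: (fg z) => [->|[fz g0]|[fz g0]]; first by rewrite !mulr0.
      by rewrite mulrA mulr_ge0// ltW.
    have ry : 0 < (r * r) * (\val f y * \val f y).
      by rewrite mulr_gt0// sq_gt0// -normr_gt0 r1.
    rewrite -(pmulr_rge0 _ ry) (_ : (r * r) * (\val f y * \val f y) *
        (\val f x * (\val f z * \val g z)) = r * (\val f x * \val f y) *
        ((\val f y * \val f z) * (r * \val g z))); last by ring.
    by rewrite mulr_ge0 ?(ltW rf)// mulr_ge0// ltW.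
  apply: sign_coherent => //; [by rewrite gx normr1|by rewrite gy|].
  have [fx0|fx0|fx0] := ltgtP (\val f x) 0; last by rewrite fx0 eqxx in fx.
    by right=> z; have := fxg z; rewrite nmulr_rge0.
  by left=> z; have := fxg z; rewrite pmulr_rge0.
suff : 0 < (\val (T f1) p * \val (T f1) q) * (\val (T g) p * \val (T g) q) /\
       0 < (\val (T f2) p * \val (T f2) q) * (\val (T g) p * \val (T g) q).
  move=> [h1 h2]; have := mulr_gt0 h1 h2; rewrite mulrACA pmulr_lgt0//.
  by apply: sq_gt0; move: (lt0r_neq0 h1); rewrite mulf_eq0 negb_or => /andP[].
split; apply: coherent => // z; (case: (gz z) => [g0|[[u1 u2] g0]|[[u1 u2] g0]];
  [exact: Or31|exact: Or32|exact: Or33]).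
Qed.

(** When the products [P1], [P2] of the values of [f1], [f2] at the two points
    have the same sign, this is [sign_locked]. If they have opposite signs and
    the products [Q1], [Q2] for the images do not, then some function in the
    range of [T] has a product of the sign opposite to [Q1] and [Q2]; its
    preimage agrees in sign with [P1] or with [P2], and [sign_locked] is
    violated. *)
Lemma relative_sign f1 f2 p q : s p <> s q ->
  \val f1 (s p) != 0 -> \val f1 (s q) != 0 ->
  \val f2 (s p) != 0 -> \val f2 (s q) != 0 ->
  0 < ((\val f1 (s p) * \val f1 (s q)) * (\val (T f1) p * \val (T f1) q)) *
      ((\val f2 (s p) * \val f2 (s q)) * (\val (T f2) p * \val (T f2) q)).
Proof.
move=> spq f1p f1q f2p f2q; rewrite mulrACA.
set P1 := \val f1 (s p) * _; set P2 := \val f2 (s p) * _.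
set Q1 := \val (T f1) p * _; set Q2 := \val (T f2) p * _.
have P0 : P1 * P2 != 0 by rewrite !mulf_neq0.
have Q0 : Q1 * Q2 != 0 by rewrite !mulf_neq0// absT_neq0.
have [P12|P12|P12] := ltgtP (P1 * P2) 0; last by rewrite P12 eqxx in P0.
  rewrite nmulr_rgt0// lt_neqAle Q0/= leNgt; apply/negP => Q12.
  have pq : p <> q by move=> pq; apply: spq; rewrite pq.
  have [r r1 rQ] : exists2 r : R, `|r| = 1 & r * Q1 < 0.
    have [Q1_lt0|Q1_gt0|Q1_eq0] := ltgtP Q1 0.
    - by exists 1; rewrite ?normr1// mul1r.
    - by exists (-1); rewrite ?normrN ?normr1// mulN1r oppr_lt0.
    - by rewrite Q1_eq0 mul0r eqxx in Q0.
  have [k [kp kq _]] :=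
    exists_bump_signed lcY hY _ _ p q r pq r1 openT openT I I.
  have [f fk] := surjT k.
  have rQ2 : r * Q2 < 0.
    rewrite -(pmulr_rlt0 _ Q12) (_ : Q1 * Q2 * (r * Q2) = (r * Q1) * (Q2 * Q2)).
      rewrite pmulr_llt0// -expr2 exprn_even_gt0//=.
      by apply: contraNneq Q0 => ->; rewrite mulr0.
    by ring.
  have r0 : r != 0 by rewrite -normr_gt0 r1.
  have P_neq0 : \val f (s p) * \val f (s q) != 0.
    by rewrite mulf_neq0// -absT_neq0 fk ?kp ?kq ?oner_eq0.
  have /orP[PP|PP] : (0 < P1 * (\val f (s p) * \val f (s q))) ||
                   (0 < P2 * (\val f (s p) * \val f (s q))).
    apply: contraTT P12; rewrite negb_or -!leNgt => /andP[P1f P2f].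
    have [f0|f0|f0] := ltgtP (\val f (s p) * \val f (s q)) 0.
    - by move: P1f P2f; rewrite !(nmulr_lle0 _ f0); exact: mulr_ge0.
    - by move: P1f P2f; rewrite !(pmulr_lle0 _ f0); exact: mulr_le0.
    - by rewrite f0 eqxx in P_neq0.
  - have := sign_locked _ _ _ _ spq PP.
    by rewrite fk kp kq mul1r mulrC ltNge ltW.
  - have := sign_locked _ _ _ _ spq PP.
    by rewrite fk kp kq mul1r mulrC ltNge ltW.
by rewrite pmulr_rgt0//; exact: sign_locked.
Qed.

Definition sign_ratio f q : R := \val (T f) q / \val f (s q).

Lemma norm_sign_ratio f q : \val f (s q) != 0 -> `|sign_ratio f q| = 1.
Proof. by move=> fq; rewrite normrM absT normfV divff// normr_eq0. Qed.

Lemma sign_ratioK f q : \val f (s q) != 0 ->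
  sign_ratio f q * \val f (s q) = \val (T f) q.
Proof. by move=> fq; rewrite divfK. Qed.

Lemma sign_ratio_sqr f q : \val f (s q) != 0 ->
  sign_ratio f q * sign_ratio f q = 1.
Proof. by move=> /norm_sign_ratio/norm_eq1[]->; rewrite ?mulrNN mulr1. Qed.

(** The sign by which [T] changes the ratio of the values of a function at two
    points does not depend on the function. *)
Lemma relative_sign_ratio f1 f2 p q :
  \val f1 (s p) != 0 -> \val f1 (s q) != 0 ->
  \val f2 (s p) != 0 -> \val f2 (s q) != 0 ->
  (s p = s q -> p = q) ->
  sign_ratio f1 p * sign_ratio f1 q = sign_ratio f2 p * sign_ratio f2 q.
Proof.
move=> f1p f1q f2p f2q s_inj.
have [/s_inj <-|spq] := pselect (s p = s q); first by rewrite !sign_ratio_sqr.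
have := relative_sign _ _ _ _ spq f1p f1q f2p f2q.
rewrite -!sign_ratioK//.
have sq (a b c d : R) :
  a * b * (c * a * (d * b)) = (a * b) ^+ 2 * (c * d) by ring.
rewrite !sq mulrACA pmulr_rgt0; last first.
  by rewrite mulr_gt0// exprn_even_gt0//= mulf_neq0.
have norm_u : `|sign_ratio f1 p * sign_ratio f1 q| = 1.
  by rewrite normrM !norm_sign_ratio ?mulr1.
have norm_v : `|sign_ratio f2 p * sign_ratio f2 q| = 1.
  by rewrite normrM !norm_sign_ratio ?mulr1.
by have [->|->] := norm_eq1 _ norm_u; have [->|->] := norm_eq1 _ norm_v; lra.
Qed.

End RelativeSigns.

(** * The representation *)

Theorem theorem1p1 (R : realType) (X Y : topologicalType)
    (lcX : locally_compact [set: X]) (hX : hausdorff_space X)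
    (lcY : locally_compact [set: Y]) (hY : hausdorff_space Y)
    (T : unit_sphere (C0 X R) -> unit_sphere (C0 Y R))
    (surjT : set_surj [set: unit_sphere (C0 X R)] [set: unit_sphere (C0 Y R)] T)
    (phaseT : phase_isometry T) :
  exists (eps : unit_sphere (C0 X R) -> R) (alpha : Y -> R) (sigma : Y -> X),
    [/\ forall f, [set -1; 1] (eps f),
        forall q, [set -1; 1] (alpha q),
        continuous alpha,
        homeomorphism sigma &
        forall (f : unit_sphere (C0 X R)) (q : Y),
          \val (T f) q = eps f * alpha q * \val f (sigma q)].
Proof.
have [s s_homeo absT] := modulus_homeomorphism lcX hX lcY hY T surjT phaseT.
have [s_cont [t [st ts _]]] := s_homeo.
have [[q0 _]|Y0] := pselect (exists q0 : Y, True); last first.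
  exists (fun=> 1), (fun=> 1), s; split=> //; try (by right).
  - by move=> q; case: Y0; exists q.
  - by move=> f q; case: Y0; exists q.
have Tsurj k : exists f, T f = k by have [f _ <-] := surjT k I; exists f.
have minT := phase_minnorm T phaseT.
pose rho := sign_ratio T s.
have rho_norm (f : sphere X R) q : \val f (s q) != 0 -> `|rho f q| = 1.
  exact: norm_sign_ratio.
have rhoE (f g : sphere X R) p q : \val f (s p) != 0 -> \val f (s q) != 0 ->
    \val g (s p) != 0 -> \val g (s q) != 0 ->
    rho f p * rho f q = rho g p * rho g q.
  move=> fp fq gp gq.
  apply: (relative_sign_ratio lcX hX lcY hY T Tsurj minT s absT) => //.
  exact: (can_inj st).
have ex_fun x ys : exists f : sphere X R, {in x :: ys, forall y, \val f y != 0}.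
  have [f [f1 _]] := exists_bump_seq (R := R) lcX hX x ys.
  by exists f => y /f1 ->; rewrite oner_eq0.
(* [alpha q] is the relative sign of [q] and the base point [q0], read off
   from any function that does not vanish at the two points. *)
have /choice[e eE] : forall q, exists f : sphere X R,
    \val f (s q0) != 0 /\ \val f (s q) != 0.
  move=> q; have [f fs] := ex_fun (s q0) [:: s q].
  by exists f; split; apply: fs; rewrite !inE eqxx ?orbT.
pose alpha q := rho (e q) q * rho (e q) q0.
have alphaE (f : sphere X R) q : \val f (s q0) != 0 -> \val f (s q) != 0 ->
    alpha q = rho f q * rho f q0.
  by move=> f0 fq; have [e0 eq] := eE q; apply: rhoE.
have /choice[z zE] : forall f : sphere X R, exists q, \val f (s q) != 0.
  move=> f; have [x fx] := sphere_attained f; exists (t x).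
  by rewrite ts -normr_gt0 fx.
have alpha_norm q : `|alpha q| = 1.
  by have [e0 eq] := eE q; rewrite normrM !rho_norm// mulr1.
have sign (a : R) : `|a| = 1 -> [set -1; 1] a.
  by move=> /norm_eq1[]->; [right|left].
exists (fun f => rho f (z f) * alpha (z f)), alpha, s; split=> //.
- by move=> f; apply: sign; rewrite normrM alpha_norm rho_norm// mulr1.
- by move=> q; exact: sign.
(* Near [q], one function [e q] computes all values of [alpha]. *)
- move=> q; have [e0 eq] := eE q.
  have es_cvg : \val (e q) (s p) @[p --> q] --> \val (e q) (s q).
    exact: (continuous_comp (s_cont q) (sphere_continuous (e q) (s q))).
  have near_alpha : {near q, (fun p => rho (e q) p * rho (e q) q0) =1 alpha}.
    near=> p; apply/esym/alphaE => //.
    near: p; exact: (cvgr_neq0 _ es_cvg).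
  apply: cvg_trans (near_eq_cvg near_alpha) _.
  apply: cvgM; last exact: cvg_cst.
  apply: cvgM; first exact: sphere_continuous.
  by apply: cvgV.
move=> f q; have [fq|fq] := eqVneq (\val f (s q)) 0.
  by apply/eqP; rewrite fq mulr0 -normr_eq0 absT fq normr0.
(* The ratios of [f] at [q] and [z f] have the same product as those of [g],
   and those of [g] are known because [g] does not vanish at [s q0] either. *)
have [g gE] := ex_fun (s q0) [:: s q; s (z f)].
have g0 : \val g (s q0) != 0 by apply: gE; rewrite !inE eqxx.
have gq : \val g (s q) != 0 by apply: gE; rewrite !inE eqxx orbT.
have gz : \val g (s (z f)) != 0 by apply: gE; rewrite !inE eqxx !orbT.
rewrite -(sign_ratioK T s f q fq) -/(rho f q); congr (_ * _).
rewrite (alphaE g q g0 gq) (alphaE g (z f) g0 gz).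
have g0_sqr : rho g q0 * rho g q0 = 1 by exact: sign_ratio_sqr.
have fz_sqr : rho f (z f) * rho f (z f) = 1 by exact: sign_ratio_sqr.
have fg := rhoE _ _ _ _ fq (zE f) gq gz.
rewrite (_ : _ * _ = rho f (z f) * (rho g q0 * rho g q0) *
  (rho g q * rho g (z f))); last by ring.
by rewrite g0_sqr mulr1 -fg mulrCA fz_sqr mulr1.
Unshelve. all: by end_near. Qed.
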